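(* Let $\mathbf{x}, \mathbf{x}' \in \mathbb{R}^3$ with $\mathbf{x} \neq \mathbf{x}'$. Let $\mathbf{m} = \frac{1}{2}(\mathbf{x} + \mathbf{x}')$, let $c = \frac{1}{2}\|\mathbf{x} - \mathbf{x}'\|$ and let $\tilde{\mathbf{u}} = \frac{1}{2c}(\mathbf{x} - \mathbf{x}')$. Then for every real number $a$ with $0 < a < c$, the set of points $\mathbf{p} \in \mathbb{R}^3$ satisfying $$(\mathbf{p} - \mathbf{m})^T\left(\left(\frac{1}{a^2} + \frac{1}{c^2-a^2}\right)\tilde{\mathbf{u}} \tilde{\mathbf{u}}^T - \frac{1}{c^2-a^2}\mathrm{Id}_3\right)(\mathbf{p} - \mathbf{m}) = 1$$ is a hyperboloid of revolution with focal points $\mathbf{x}$ and $\mathbf{x}'$.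
   Context: $\|\cdot\|$ is the Euclidean norm on $\mathbb{R}^3$, vectors are column vectors, and $\mathrm{Id}_3$ is the $3\times 3$ identity matrix. A hyperboloid of revolution with focal points $\mathbf{x} \neq \mathbf{x}'$ is here the (two-sheeted) surface obtained by rotating a hyperbola with foci $\mathbf{x}, \mathbf{x}'$ about the line through its foci; equivalently, a set of the form $\{\mathbf{p} \in \mathbb{R}^3 : |\,\|\mathbf{p}-\mathbf{x}\| - \|\mathbf{p}-\mathbf{x}'\|\,| = \delta\}$ for some constant $\delta$ with $0 < \delta < \|\mathbf{x}-\mathbf{x}'\|$. *)

(* Defs.v *)
From HB Require Import structures.
From mathcomp Require Import all_boot all_order all_algebra.
From mathcomp Require Import boolp classical_sets reals.
Set Implicit Arguments.
Unset Strict Implicit.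
Unset Printing Implicit Defensive.
Import Order.TTheory GRing.Theory Num.Theory.
Local Open Scope classical_set_scope.
Local Open Scope ring_scope.

(** The norm that MathComp-Analysis puts on matrices is the sup norm, hence a
    separate Euclidean norm. *)
Definition enorm (R : realType) (n : nat) (v : 'cV[R]_n) : R :=
  Num.sqrt (\sum_(i < n) v i 0 ^+ 2).

(** Plane through [q] with normal vector [n]; it is a plane only if [n != 0]. *)
Definition plane (R : realType) (q n : 'cV[R]_3) : set 'cV[R]_3 :=
  [set p | (n^T *m (p - q)) 0 0 = 0].

(** [H] is a hyperbola with foci [x] and [x'], lying in some plane through both
    foci: the points of that plane whose distances to the foci differ by a
    constant. The bounds on [delta] exclude the degenerate cases. *)
Definition is_hyperbola (R : realType) (x x' : 'cV[R]_3)
    (H : set 'cV[R]_3) : Prop :=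
  exists (n : 'cV[R]_3) (delta : R),
    [/\ n != 0, plane x n x', 0 < delta, delta < enorm (x - x') &
        H = [set p | plane x n p /\
                     `| enorm (p - x) - enorm (p - x') | = delta]].

(** The rotation [p |-> x + Q (p - x)] about the line through [x] and [x']:
    [Q] is in SO(3) and fixes the direction of the axis. *)
Definition is_axial_rotation (R : realType) (x x' : 'cV[R]_3)
    (Q : 'M[R]_3) : Prop :=
  [/\ Q^T *m Q = 1%:M, \det Q = 1 & Q *m (x' - x) = x' - x].

Definition surface_of_revolution (R : realType) (x x' : 'cV[R]_3)
    (H : set 'cV[R]_3) : set 'cV[R]_3 :=
  [set p | exists2 Q, is_axial_rotation x x' Q &
           exists2 q, H q & p = x + Q *m (q - x)].

(** Revolution is about the line through the foci, so the surface has two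
    sheets. *)
Definition is_hyperboloid_of_revolution (R : realType) (x x' : 'cV[R]_3)
    (S : set 'cV[R]_3) : Prop :=
  x != x' /\
  exists2 H, is_hyperbola x x' H & S = surface_of_revolution x x' H.

(* Main.v *)
Require Import Defs.
From mathcomp Require Import all_boot all_order all_algebra.
From mathcomp Require Import boolp classical_sets reals.
From mathcomp Require Import ring lra.
Import Order.TTheory GRing.Theory Num.Theory.
Local Open Scope classical_set_scope.
Local Open Scope ring_scope.

(** The proof has two independent halves.

    The first is the classical planar computation, valid in any dimension.
    Write [w = p - m], [s] for the component of [w] along the unit vector [u],
    and [N] for the squared length of [w]. The foci are [m + c u] and [m - c u],
    so the squared focal distances of [p] are [N - 2cs + c^2] and
    [N + 2cs + c^2]. Squaring away the two square roots turns the condition that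
    the focal distances differ by [2a] into [c^2 s^2 = a^2 (N + c^2 - a^2)],
    which is the quadric equation cleared of denominators. The one step of that
    squaring which is not an equivalence on its own is repaired by
    Cauchy-Schwarz, [s^2 <= N] ([focal_difference_quadric]).

    The second half shows that the locus where the focal distances differ by
    [delta] is swept out by its section with a plane through the axis. One
    inclusion holds because an axial rotation fixes both foci and preserves
    distances ([axial_rotation_focal_distances]). For the other, every point has
    to be turned about the axis into the chosen plane: an orthogonal change of
    frame, given by a Householder reflection, moves the axis to the first
    coordinate axis ([orthogonal_align]), where the turn is polar coordinates
    in the last two variables ([rotate_into_coordinate_plane]). Conjugating back
    gives an axial rotation ([rotate_into_axial_plane]). *)

(** * The Euclidean inner product *)

Definition dot {R : realType} {n : nat} (v w : 'cV[R]_n) : R :=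
  (v^T *m w) 0 0.

Section InnerProduct.
Variables (R : realType) (n : nat).
Implicit Types (u v w : 'cV[R]_n) (k : R) (Q : 'M[R]_n).

Lemma dotC v w : dot v w = dot w v.
Proof. by rewrite /dot !mxE; apply: eq_bigr => i _; rewrite !mxE mulrC. Qed.

Lemma dotDr u v w : dot u (v + w) = dot u v + dot u w.
Proof. by rewrite /dot mulmxDr mxE. Qed.

Lemma dotZr u k v : dot u (k *: v) = k * dot u v.
Proof. by rewrite /dot -scalemxAr mxE. Qed.

Lemma dotNr u v : dot u (- v) = - dot u v.
Proof. by rewrite /dot mulmxN mxE. Qed.

Lemma dotDl u v w : dot (v + w) u = dot v u + dot w u.
Proof. by rewrite ![dot _ u]dotC dotDr. Qed.

Lemma dotZl u k v : dot (k *: v) u = k * dot v u.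
Proof. by rewrite ![dot _ u]dotC dotZr. Qed.

Lemma dotNl u v : dot (- v) u = - dot v u.
Proof. by rewrite ![dot _ u]dotC dotNr. Qed.

Definition dotE := (dotDl, dotDr, dotNl, dotNr, dotZl, dotZr).

Lemma dot_sum v : dot v v = \sum_(i < n) v i 0 ^+ 2.
Proof. by rewrite /dot mxE; apply: eq_bigr => i _; rewrite mxE expr2. Qed.

Lemma dot_ge0 v : 0 <= dot v v.
Proof. by rewrite dot_sum sumr_ge0 // => i _; rewrite sqr_ge0. Qed.

Lemma dot_eq0 v : (dot v v == 0) = (v == 0).
Proof.
apply/eqP/eqP => [|->]; last by rewrite dot_sum big1 // => i _; rewrite mxE expr0n.
rewrite dot_sum => /eqP; rewrite psumr_eq0 => [/allP v0|i _]; last exact: sqr_ge0.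
apply/matrixP => i j; rewrite ord1 mxE; apply/eqP.
by have := v0 i (mem_index_enum i); rewrite sqrf_eq0.
Qed.

Lemma enormE v : enorm v = Num.sqrt (dot v v).
Proof. by rewrite dot_sum. Qed.

Lemma enorm_ge0 v : 0 <= enorm v.
Proof. exact: sqrtr_ge0. Qed.

Lemma sqr_enorm v : enorm v ^+ 2 = dot v v.
Proof. by rewrite enormE sqr_sqrtr ?dot_ge0. Qed.

Lemma enorm_orthogonal Q v : Q^T *m Q = 1%:M -> enorm (Q *m v) = enorm v.
Proof.
move=> QQ; rewrite !enormE /dot trmx_mul -mulmxA [Q^T *m _]mulmxA QQ.
by rewrite mul1mx.
Qed.

(** Cauchy-Schwarz against a unit vector: the difference of the two sides is the
    squared length of the component of [w] orthogonal to [u]. *)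
Lemma sqr_dot_le u w : dot u u = 1 -> dot u w ^+ 2 <= dot w w.
Proof.
move=> u1; have := dot_ge0 (w - dot u w *: u).
rewrite !dotE u1 [dot w u]dotC; lra.
Qed.

Lemma quadric_dot u w (k l : R) :
  (w^T *m (k *: (u *m u^T) - l *: 1%:M) *m w) 0 0
  = k * dot u w ^+ 2 - l * dot w w.
Proof.
have rank1 : (w^T *m u *m u^T *m w) 0 0 = dot u w ^+ 2.
  by rewrite -mulmxA mxE big_ord1 -!/(dot _ _) [dot w u]dotC expr2.
rewrite mulmxBr mulmxBl -!scalemxAr -!scalemxAl mulmx1 !mulmxA.
by rewrite -rank1 /dot !mxE.
Qed.

End InnerProduct.

(** * Focal distances and the quadric *)

(** [r] and [r'] are the two focal distances. In the direction from the quadric,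
    [s^2 <= N] forces [a^2 <= s^2], hence [0 <= N + c^2 - 2a^2]; this is the sign
    under which equality of squares gives [r r' = N + c^2 - 2a^2]. *)
Lemma focal_difference_quadric {R : realType} (a c s N r r' : R) :
  0 < a -> a < c -> 0 <= r -> 0 <= r' -> s ^+ 2 <= N ->
  r ^+ 2 = N - 2 * c * s + c ^+ 2 -> r' ^+ 2 = N + 2 * c * s + c ^+ 2 ->
  `|r - r'| = 2 * a <->
  ((a ^+ 2)^-1 + (c ^+ 2 - a ^+ 2)^-1) * s ^+ 2 - (c ^+ 2 - a ^+ 2)^-1 * N = 1.
Proof.
move=> a0 ac r0 r0' sN rE rE'.
have a20 : 0 < a ^+ 2 by rewrite exprn_gt0.
have b20 : 0 < c ^+ 2 - a ^+ 2 by rewrite subr_gt0 ltr_pXn2r ?nnegrE //; lra.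
have quadricE : ((a ^+ 2)^-1 + (c ^+ 2 - a ^+ 2)^-1) * s ^+ 2
    - (c ^+ 2 - a ^+ 2)^-1 * N
    = (c ^+ 2 * s ^+ 2 - a ^+ 2 * N) / (a ^+ 2 * (c ^+ 2 - a ^+ 2)).
  by field; rewrite !gt_eqF // -1?(pmulr_rgt0 _ a0) -?expr2.
have ab0 : a ^+ 2 * (c ^+ 2 - a ^+ 2) != 0 by rewrite mulf_neq0 ?gt_eqF.
have clear_denominators : c ^+ 2 * s ^+ 2 - a ^+ 2 * N = a ^+ 2 * (c ^+ 2 - a ^+ 2)
    <-> ((a ^+ 2)^-1 + (c ^+ 2 - a ^+ 2)^-1) * s ^+ 2
        - (c ^+ 2 - a ^+ 2)^-1 * N = 1.
  rewrite quadricE; split => [->|/(canRL (mulfVK ab0)) ->]; last by rewrite mul1r.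
  by rewrite divff.
apply: iff_trans clear_denominators.
have sqr_prod : (r * r') ^+ 2 = (N + c ^+ 2) ^+ 2 - 4 * c ^+ 2 * s ^+ 2.
  by rewrite exprMn rE rE'; ring.
have sqr_diff : (r - r') ^+ 2 = 2 * (N + c ^+ 2) - 2 * (r * r').
  by rewrite sqrrB rE rE'; ring.
split=> [diffE|quadric].
  have prodE : r * r' = N + c ^+ 2 - 2 * a ^+ 2.
    have : (r - r') ^+ 2 = (2 * a) ^+ 2 by rewrite -diffE real_normK ?num_real.
    by rewrite sqr_diff exprMn; lra.
  by move: sqr_prod; rewrite prodE; lra.
have a2s2 : a ^+ 2 <= s ^+ 2.
  rewrite -(ler_pM2l b20).
  have := ler_wpM2l (ltW a20) sN; lra.
have prodE : r * r' = N + c ^+ 2 - 2 * a ^+ 2.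
  apply/eqP; rewrite -(@eqrXn2 _ 2%N) ?mulr_ge0 //; last lra.
  by rewrite sqr_prod; apply/eqP; lra.
apply/eqP; rewrite -(@eqrXn2 _ 2%N) // ?mulr_ge0 ?(ltW a0) //.
rewrite real_normK ?num_real //.
by rewrite sqr_diff prodE; apply/eqP; lra.
Qed.

Lemma quadric_focal_locus {R : realType} {n : nat} (x x' p : 'cV[R]_n) (a : R) :
  let m := 2^-1 *: (x + x') in
  let c := 2^-1 * enorm (x - x') in
  let u := (2 * c)^-1 *: (x - x') in
  0 < a -> a < c ->
  `|enorm (p - x) - enorm (p - x')| = 2 * a <->
  ((p - m)^T *m
     (((a ^+ 2)^-1 + (c ^+ 2 - a ^+ 2)^-1) *: (u *m u^T)
      - (c ^+ 2 - a ^+ 2)^-1 *: 1%:M) *m (p - m)) 0 0 = 1.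
Proof.
move=> m c u a0 ac; rewrite quadric_dot.
have c0 : 0 < c by exact: lt_trans ac.
have c2E : (2 * c) ^+ 2 = dot (x - x') (x - x').
  by rewrite -sqr_enorm /c mulrA divff ?mul1r ?pnatr_eq0.
have u1 : dot u u = 1.
  by rewrite dotZl dotZr -c2E; field; rewrite gt_eqF.
have cuE : c *: u = 2^-1 *: (x - x').
  by rewrite /u scalerA; congr (_ *: _); field; rewrite gt_eqF.
have pxE : p - x = (p - m) - c *: u.
  by rewrite cuE /m; apply/matrixP => i j; rewrite !mxE; field.
have pxE' : p - x' = (p - m) + c *: u.
  by rewrite cuE /m; apply/matrixP => i j; rewrite !mxE; field.
clearbody m c u.
apply: focal_difference_quadric; rewrite ?enorm_ge0 ?sqr_dot_le //.
- rewrite sqr_enorm pxE; move: (p - m) => w.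
  by rewrite !dotE u1 [dot w u]dotC; ring.
- rewrite sqr_enorm pxE'; move: (p - m) => w.
  by rewrite !dotE u1 [dot w u]dotC; ring.
Qed.

(** * Rotations about the focal axis *)

Lemma axial_rotation_focal_distances {R : realType} (x x' q : 'cV[R]_3)
    (Q : 'M[R]_3) :
  is_axial_rotation x x' Q ->
  enorm (x + Q *m (q - x) - x) = enorm (q - x) /\
  enorm (x + Q *m (q - x) - x') = enorm (q - x').
Proof.
move=> [QQ _ Qaxis]; split; first by rewrite addrAC subrr add0r enorm_orthogonal.
have -> : x + Q *m (q - x) - x' = Q *m (q - x').
  have -> : q - x' = (q - x) - (x' - x) by rewrite opprB addrA subrK.
  by rewrite [RHS]mulmxBr Qaxis opprB addrA [x + _]addrC.
exact: enorm_orthogonal.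
Qed.

(** The witness is the Householder reflection that exchanges [d] and the vector
    of the same length along the first basis vector; its mirror is orthogonal to
    their difference [v]. If [v] is zero then, as the inverse of zero is zero,
    the same formula gives the identity. *)
Lemma orthogonal_align {R : realType} {n : nat} (d : 'cV[R]_n.+1) :
  exists O : 'M[R]_n.+1,
    O^T *m O = 1%:M /\ O *m d = enorm d *: delta_mx 0 0.
Proof.
pose e : 'cV[R]_n.+1 := delta_mx 0 0.
pose v := d - enorm d *: e; pose k := (dot v v)^-1.
pose O : 'M[R]_n.+1 := 1%:M - (2 * k) *: (v *m v^T).
have Ov w : O *m w = w - (2 * k * dot v w) *: v.
  rewrite mulmxBl mul1mx -scalemxAl -mulmxA [v^T *m w]mx11_scalar.
  by rewrite mul_mx_scalar scalerA.
have e1 : dot e e = 1 by rewrite /dot trmx_delta mul_delta_mx mxE !eqxx.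
have kv : k * dot v v * k = k.
  have [v0|v0] := eqVneq (dot v v) 0; first by rewrite /k v0 invr0 mulr0.
  by rewrite /k mulVf // mul1r.
have kvv : (k * dot v v) *: v = v.
  have [/eqP v0|v0] := eqVneq (dot v v) 0.
    by move: v0; rewrite dot_eq0 => /eqP ->; rewrite scaler0.
  by rewrite /k mulVf // scale1r.
have vd : 2 * dot v d = dot v v.
  by rewrite /v !dotE e1 -sqr_enorm [dot e d]dotC; ring.
exists O; split.
  have -> : O^T = O.
    by rewrite /O linearB /= linearZ /= trmx_mul trmxK trmx1.
  rewrite {2}/O mulmxBr mulmx1 -scalemxAr mulmxA Ov.
  rewrite mulmxBl -scalemxAl /O scalerBr scalerA.
  have -> : 2 * k * (2 * k * dot v v) = 2 * k + 2 * k.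
    by rewrite -[in RHS]kv; ring.
  by rewrite scalerDl opprB addrK subrK.
by rewrite Ov mulrAC vd [_ * k]mulrC kvv /v opprB addrC subrK.
Qed.

Lemma polar_coordinates {R : realType} (y z : R) :
  exists C S r : R, [/\ C ^+ 2 + S ^+ 2 = 1, y = r * C & z = r * S].
Proof.
pose r := Num.sqrt (y ^+ 2 + z ^+ 2).
have r2 : r ^+ 2 = y ^+ 2 + z ^+ 2 by rewrite sqr_sqrtr ?addr_ge0 ?sqr_ge0.
have [r0|r0] := eqVneq r 0.
  (* At the origin every angle works. *)
  move/eqP: r2; rewrite r0 expr0n eq_sym paddr_eq0 ?sqr_ge0 // !sqrf_eq0.
  case/andP=> /eqP -> /eqP ->; exists 1, 0, 0.
  by rewrite expr1n expr0n addr0 !mul0r.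
exists (y / r), (z / r), r; split; rewrite 1?[RHS]mulrC ?mulfVK //.
by rewrite !expr_div_n -mulrDl -r2 divff ?expf_neq0.
Qed.

(** A turn about the first axis by the polar angle of the last two coordinates,
    carrying [(y0, r, 0)] to [y]. *)
Lemma rotate_into_coordinate_plane {R : realType} (y : 'cV[R]_3) :
  exists (T : 'M[R]_3) (q : 'cV[R]_3),
    [/\ T^T *m T = 1%:M, \det T = 1,
        T *m delta_mx 0 0 = delta_mx 0 0 :> 'cV_3,
        q (2 : 'I_3) 0 = 0 & y = T *m q].
Proof.
have [C [S [r [CS y1 y2]]]] := polar_coordinates (y 1 0) (y 2 0).
pose T : 'M[R]_3 := \matrix_(i, j)
  (nth [::] [:: [:: 1; 0; 0]; [:: 0; C; - S]; [:: 0; S; C]] i)`_j.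
pose q : 'cV[R]_3 := \col_i [:: y 0 0; r; 0]`_i.
have col3P (v w : 'cV[R]_3) :
    v 0 0 = w 0 0 -> v 1 0 = w 1 0 -> v 2 0 = w 2 0 -> v = w.
  move=> h0 h1 h2; apply/matrixP => i j; rewrite ord1.
  by case: i => [[|[|[|]]]] // i; [move: h0|move: h1|move: h2];
    rewrite /= => h; apply: (etrans (etrans _ h)); congr (_ _ _); apply: val_inj.
exists T, q; split.
- apply/matrixP => i j; rewrite !mxE !big_ord_recr big_ord0 /= !mxE /=.
  case: i => [[|[|[|]]]] // i; case: j => [[|[|[|]]]] // j;
  rewrite /= ?mulr1n ?mulr0n; lra.
- rewrite (expand_det_row _ 0) !big_ord_recr big_ord0 /= !mxE /= !mul0r.
  rewrite /cofactor (expand_det_row _ 0) !big_ord_recr big_ord0 /= !mxE /=.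
  rewrite /cofactor !det_mx11 !mxE /=; lra.
- by apply: col3P; rewrite !mxE !big_ord_recr big_ord0 /= !mxE /=; ring.
- by rewrite mxE.
- by apply: col3P; rewrite !mxE !big_ord_recr big_ord0 /= !mxE /= ?y1 ?y2; ring.
Qed.

(** The single normal [n] has to serve every [w], because one planar section must
    sweep out the whole surface. In the frame [O] adapted to [d] the third basis
    vector is such a normal, and the rotation comes from
    [rotate_into_coordinate_plane] by conjugation. Conjugating keeps the
    determinant at 1 although [O] itself may reverse orientation. *)
Lemma rotate_into_axial_plane {R : realType} (d : 'cV[R]_3) :
  exists n : 'cV[R]_3, [/\ n != 0, dot n d = 0 &
    forall w, exists Q q,
      [/\ Q^T *m Q = 1%:M, \det Q = 1, Q *m d = d, dot n q = 0 & w = Q *m q]].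
Proof.
have [O [OO Od]] := orthogonal_align d.
have OO' : O *m O^T = 1%:M by apply: mulmx1C.
have dE : d = enorm d *: (O^T *m delta_mx 0 0).
  by rewrite scalemxAr -Od mulmxA OO mul1mx.
pose e2 : 'cV[R]_3 := delta_mx 2 0.
have dot_n v : dot (O^T *m e2) v = (O *m v) 2 0.
  rewrite /dot trmx_mul trmxK -mulmxA trmx_delta -rowE; exact: mxE.
exists (O^T *m e2); split.
- rewrite -dot_eq0 dot_n mulmxA OO' mul1mx mxE !eqxx; exact: oner_neq0.
- by rewrite dot_n Od !mxE mulr0.
move=> w; have [T [y [TT detT Te y2 OwE]]] := rotate_into_coordinate_plane (O *m w).
exists (O^T *m T *m O), (O^T *m y); split.
- rewrite !trmx_mul trmxK -!mulmxA (mulmxA O) OO' mul1mx (mulmxA T^T) TT.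
  by rewrite mul1mx OO.
- by rewrite !det_mulmx detT mulr1 -det_mulmx OO det1.
- by rewrite -!mulmxA Od -!scalemxAr Te -dE.
- by rewrite dot_n mulmxA OO' mul1mx.
- by rewrite -!mulmxA (mulmxA O) OO' mul1mx -OwE mulmxA OO mul1mx.
Qed.

(** Points are moved into the plane section along circles about the axis, on which
    both focal distances are constant; so the section inherits the constant
    [delta] and generates the whole locus. *)
Lemma focal_difference_hyperboloid {R : realType} (x x' : 'cV[R]_3)
    (delta : R) :
  x != x' -> 0 < delta -> delta < enorm (x - x') ->
  is_hyperboloid_of_revolution x x'
    [set p | `|enorm (p - x) - enorm (p - x')| = delta].
Proof.
move=> xx' delta0 delta_lt; split=> //.
have [n [n0 n_axis turn]] := rotate_into_axial_plane (x' - x).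
exists [set p | plane x n p /\ `|enorm (p - x) - enorm (p - x')| = delta].
  by exists n, delta.
apply/seteqP; split=> [p /= pdelta|p /= [Q rotQ [q [_ qdelta] ->]]]; last first.
  by have [-> ->] := axial_rotation_focal_distances x x' q Q rotQ.
have [Q [q [QQ detQ Qaxis nq pE]]] := turn (p - x).
have rotQ : is_axial_rotation x x' Q by [].
have pE' : p = x + Q *m (x + q - x) by rewrite [x + q]addrC addrK -pE addrC subrK.
exists Q => //; exists (x + q) => //; split.
  by rewrite /plane /= [x + q]addrC addrK.
have [<- <-] := axial_rotation_focal_distances x x' (x + q) Q rotQ.
by rewrite -pE'.
Qed.

Theorem theorem1 (R : realType) (x x' : 'cV[R]_3) (hx : x != x') :
  let m := 2^-1 *: (x + x') in
  let c := 2^-1 * enorm (x - x') in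
  let u := (2 * c)^-1 *: (x - x') in
  forall a : R, 0 < a -> a < c ->
    is_hyperboloid_of_revolution x x'
      [set p : 'cV[R]_3 |
        ((p - m)^T *m
         (((a ^+ 2)^-1 + (c ^+ 2 - a ^+ 2)^-1) *: (u *m u^T)
          - (c ^+ 2 - a ^+ 2)^-1 *: 1%:M) *m
         (p - m)) 0 0 = 1].
Proof.
move=> m c u a a0 ac.
have cE : enorm (x - x') = 2 * c by rewrite /c mulrA divff ?mul1r ?pnatr_eq0.
rewrite [X in is_hyperboloid_of_revolution _ _ X](_ : _ =
    [set p | `|enorm (p - x) - enorm (p - x')| = 2 * a]); last first.
  by apply/seteqP; split=> p /= /(quadric_focal_locus x x' p a a0 ac).
by apply: focal_difference_hyperboloid; rewrite // ?cE; lra.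
Qed.
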